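(* Let $\mathbb{K}$ be a field of characteristic $0$ and let $d\geq 4$. Let $M_1,\ldots,M_\tau$, $\tau=\binom{d+1}{2}$, be all the monomials of degree $d-1$ in the variables $u_1,u_2,u_3$, and let $f=\sum_{j=1}^{\tau}x_jM_j\in\mathbb{K}[x_1,\ldots,x_\tau,u_1,u_2,u_3]$ (the full Perazzo polynomial of type $3$ and degree $d$). Let $A=Q/\operatorname{Ann}_Q(f)$, where $Q=\mathbb{K}[X_1,\ldots,X_\tau,U_1,U_2,U_3]$ acts on $\mathbb{K}[x_1,\ldots,x_\tau,u_1,u_2,u_3]$ by $X_i=\partial/\partial x_i$, $U_i=\partial/\partial u_i$. Then the Hilbert function $H=(1,h_1,\ldots,h_{d-1},1)$ of $A$ (a standard graded Artinian Gorenstein algebra of socle degree $d$ and codimension $r=3+\binom{d+1}{2}$) is minimal: if $\hat H=(1,\hat h_1,\ldots,\hat h_{d-1},1)$ is the Hilbert function of a standard graded Artinian Gorenstein $\mathbb{K}$-algebra of socle degree $d$ and codimension $r$ with $\hat h_i\leq h_i$ for all $i$, then $\hat H=H$.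
   Context: A standard graded Artinian Gorenstein $\mathbb{K}$-algebra of socle degree $d$ has Hilbert function $(1,h_1,\ldots,h_d)$ with $h_d=1$ and $h_i=h_{d-i}$; its codimension is $h_1$ (ideals are assumed to contain no linear forms). *)

(* Defs.v *)
From HB Require Import structures.
From mathcomp Require Import all_boot all_order all_algebra.
From mathcomp Require Import mpoly.
From Stdlib Require Import ClassicalEpsilon.

Set Implicit Arguments.
Unset Strict Implicit.
Unset Printing Implicit Defensive.

Import GRing.Theory.
Local Open Scope ring_scope.

Section Defs.
Variables (K : fieldType) (n : nat).
Implicit Types (I : pred {mpoly K[n]}) (p q : {mpoly K[n]}).

Definition is_ideal I : Prop :=
  [/\ 0 \in I,
      (forall p q, p \in I -> q \in I -> p + q \in I) &
      (forall p q, p \in I -> q * p \in I)].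

Definition is_homog_ideal I : Prop :=
  is_ideal I /\ (forall p (j : nat), p \in I -> pihomog mdeg j p \in I).

Definition HF_at I (i h : nat) : Prop :=
  exists v : 'I_h -> {mpoly K[n]},
    [/\ (forall j, v j \is i.-homog),
        (forall c : 'I_h -> K, \sum_j c j *: v j \in I -> forall j, c j = 0) &
        (forall p, p \is i.-homog ->
           exists c : 'I_h -> K, p - \sum_j c j *: v j \in I)].

Definition hilb I (i : nat) : nat := epsilon (inhabits 0%N) (HF_at I i).

Definition artinian I : Prop :=
  exists (k : nat) (v : 'I_k -> {mpoly K[n]}),
    forall p, exists c : 'I_k -> K, p - \sum_j c j *: v j \in I.

Definition in_socle I p : Prop := forall i : 'I_n, p * 'X_i \in I.

Definition gorenstein_socle I : Prop :=
  exists s, [/\ s \notin I, in_socle I s &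
     forall p, in_socle I p -> exists c : K, p - c *: s \in I].

Definition socle_degree I (d : nat) : Prop :=
  (exists p, p \is d.-homog /\ p \notin I) /\
  (forall (j : nat) p, (d < j)%N -> p \is j.-homog -> p \in I).

Definition SGAG I (d : nat) : Prop :=
  [/\ is_homog_ideal I, artinian I, gorenstein_socle I & socle_degree I d].

Definition diff_act q p : {mpoly K[n]} :=
  \sum_(m <- msupp q) q@_m *: p^`M[m].

Definition Ann (f : {mpoly K[n]}) : pred {mpoly K[n]} :=
  [pred q | diff_act q f == 0].

End Defs.

(* Full Perazzo polynomial of type 3 and degree d, in the ring with
   tau + 3 variables: variables lshift 3 j (j < tau) are x_1..x_tau,
   variables rshift tau k (k < 3) are u_1,u_2,u_3. The enumeration
   e : 'I_tau -> 'X_{1..3} lists the monomials M_j of degree d-1 in u. *)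
Definition perazzo (K : fieldType) (tau : nat) (e : 'I_tau -> 'X_{1..3}) :
  {mpoly K[tau + 3]} :=
  \sum_(j < tau) 'X_(lshift 3 j) *
     \prod_(k < 3) 'X_(rshift tau k) ^+ (e j k).

(* Main.v *)
Require Import Defs.
From HB Require Import structures.
From mathcomp Require Import all_boot all_order all_algebra.
From mathcomp Require Import mpoly ssrcomplements.
From mathcomp Require Import zify.
From Stdlib Require Import Classical ClassicalEpsilon.

(* Let A be standard graded Artinian Gorenstein of socle degree d, and for a
   linear form l let k_j be the dimension of the kernel of l on A_(d-j). As A is
   self-dual, l : A_m -> A_(m+1) and l : A_(d-m-1) -> A_(d-m) have equal rank, so
   with j = d - i + 1
       h_i = h_(i-1) - k_j + k_i.
   Dually, k_j is the Hilbert function of A/lA. Macaulay's theorem says that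
   k_j <= k_i if k_i <= i, and k_j <= k_i + (j - i) if k_i <= 2i; otherwise
   k_i > 2i, and Green's hyperplane restriction theorem gives k_j <= i + j + 1
   for a suitable l. If h_(i-1) is the Perazzo value
   binom(i+1,2) + binom(d-i+3,2), each case yields
   h_i >= binom(i+2,2) + binom(d-i+2,2), the next Perazzo value. Only
   these numerical instances of Macaulay's and Green's theorems are needed; they
   follow from the recursion, for a subspace F of A_m and generic l, l',
   dim (F & ker l) <= dim (F & ker l & ker l') + dim (l' F & ker l). *)

Set Implicit Arguments.
Unset Strict Implicit.
Unset Printing Implicit Defensive.

Import GRing.Theory.
Local Open Scope ring_scope.

(** * Linear algebra over an infinite field *)

(** In characteristic 0 the images of 0, ..., [size p - 1] in K are distinct, too many to be roots
    of a nonzero [p]. *)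
Lemma exists_not_root (K : fieldType) (p : {poly K}) :
  [pchar K] =i pred0 -> p != 0 -> exists t, ~~ root p t.
Proof.
move=> /pcharf0P K0 p0; apply: NNPP => nex.
pose rs := [seq k%:R : K | k <- iota 0 (size p)].
have: (size rs < size p)%N.
  apply: max_poly_roots p0 _ _.
    by apply/allP=> t _; apply/negP=> /negP nr; apply: nex; exists t.
  rewrite map_inj_uniq ?iota_uniq // => a b /eqP ab; apply/eqP.
  wlog: a b ab / (a <= b)%N.
    move=> W; case/orP: (leq_total a b) => le; first exact: W.
    by rewrite eq_sym; apply: W => //; rewrite eq_sym.
  move=> leab; move: ab; rewrite eq_sym -subr_eq0 -natrB // K0 subn_eq0 => leba.
  by rewrite eqn_leq leab.
by rewrite size_map size_iota ltnn.
Qed.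

(** With [mxrank_le_factor] this turns a lower bound on a rank into the non-vanishing of a
    determinant. *)
Lemma mxrank_ge_inverse (K : fieldType) (p q r : nat) (A : 'M[K]_(p, q)) :
  (r <= \rank A)%N -> exists (P : 'M_(r, p)) (Q : 'M_(q, r)), P *m A *m Q = 1%:M.
Proof.
move=> rA.
have [P PA] : exists P : 'M_(r, p), \rank (P *m A) = r.
  have [D defA] : exists D, row_base A = D *m A.
    by apply/submxP; rewrite eq_row_base.
  exists (pid_mx r *m D); rewrite -mulmxA -defA mxrankMfree ?row_base_free //.
  by rewrite rank_pid_mx.
have /row_freeP[Q PAQ] : row_free (P *m A) by rewrite /row_free PA.
by exists P, Q.
Qed.

Lemma mxrank_le_factor (K : fieldType) (p q r : nat) (A : 'M[K]_(p, q))
    (P : 'M_(r, p)) (Q : 'M_(q, r)) :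
  \det (P *m A *m Q) != 0 -> (r <= \rank A)%N.
Proof.
rewrite -unitfE -unitmxE => /mxrank_unit; set B := _ *m _ => rB.
by rewrite -rB (leq_trans (mxrankM_maxl _ _)) ?mxrankM_maxr.
Qed.

(** Semicontinuity of the rank: a determinant that certifies the bound at [t0] is a nonzero
    polynomial in t. *)
Lemma mxrank_line (K : fieldType) (p q r : nat) (A B : 'M[K]_(p, q)) t0 :
  (r <= \rank (A + t0 *: B)%R)%N ->
  exists2 f : {poly K}, f != 0 &
    forall t, ~~ root f t -> (r <= \rank (A + t *: B)%R)%N.
Proof.
move=> /mxrank_ge_inverse [P [Q PQ]].
pose M := map_mx polyC (P *m A *m Q) + 'X *: map_mx polyC (P *m B *m Q).
have evM t : (\det M).[t] = \det (P *m (A + t *: B) *m Q).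
  rewrite -[LHS]/(horner_eval t (\det M)) -det_map_mx; congr (\det _).
  rewrite mulmxDr mulmxDl -scalemxAr -scalemxAl /M.
  set PA := P *m A *m Q; set PB := P *m B *m Q.
  by apply/matrixP=> i j; rewrite !mxE /= horner_evalE !hornerE.
exists (\det M).
  apply/eqP=> M0; move: (evM t0); rewrite PQ det1 M0 horner0 => /eqP.
  by rewrite eq_sym oner_eq0.
by move=> t; rewrite rootE evM; apply: mxrank_le_factor.
Qed.

(** The bounds known at t = 0 and at t = 1 each fail only at roots of a nonzero polynomial, so some
    t satisfies both. *)
Lemma mxrank_line2 (K : fieldType) p q r p' q' r' (A0 A1 : 'M[K]_(p, q))
    (B0 B1 : 'M[K]_(p', q')) : [pchar K] =i pred0 ->
  (r <= \rank A0)%N -> (r' <= \rank B1)%N ->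
  exists t, (r <= \rank (A0 + t *: (A1 - A0))%R)%N /\
            (r' <= \rank (B0 + t *: (B1 - B0))%R)%N.
Proof.
move=> K0 rA rB.
have [f f0 fP] : exists2 f : {poly K}, f != 0 & forall t, ~~ root f t ->
    (r <= \rank (A0 + t *: (A1 - A0))%R)%N.
  by apply: (mxrank_line (t0 := 0)); rewrite scale0r addr0.
have [g g0 gP] : exists2 g : {poly K}, g != 0 & forall t, ~~ root g t ->
    (r' <= \rank (B0 + t *: (B1 - B0))%R)%N.
  by apply: (mxrank_line (t0 := 1)); rewrite scale1r addrC subrK.
have [t] := exists_not_root K0 (mulf_neq0 f0 g0).
by rewrite rootM negb_or => /andP[/fP ? /gP ?]; exists t.
Qed.

Lemma submx_of_rank (K : fieldType) p n r (A : 'M[K]_(p, n)) :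
  (r <= \rank A)%N -> exists G : 'M_(r, n), (G <= A)%MS /\ \rank G = r.
Proof.
move=> rA; exists (pid_mx r *m row_base A); split.
  by rewrite (submx_trans (submxMl _ _)) ?eq_row_base.
by rewrite mxrankMfree ?row_base_free ?rank_pid_mx.
Qed.

(** The quotient of [F :&: kermx L] by [G :&: kermx L] embeds into F/G. *)
Lemma mxrank_cap_ker_le (K : fieldType) p p' n q (F : 'M[K]_(p, n))
    (G : 'M[K]_(p', n)) (L : 'M[K]_(n, q)) : (G <= F)%MS ->
  (\rank (F :&: kermx L) + \rank G <= \rank (G :&: kermx L) + \rank F)%N.
Proof.
move=> GF; have := mxrankS (submxMr L GF).
have := mxrank_mul_ker F L; have := mxrank_mul_ker G L; lia.
Qed.

(** * Numerical Green and Macaulay bounds for commuting multiplication maps *)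

Section Core.

Variables (K : fieldType) (n : nat) (h : nat -> nat).
Variable X : forall m : nat, 'I_n -> 'M[K]_(h m, h m.+1).

(** Row vectors of length [h m] stand for A_m and [X m k] for multiplication by the variable k; this
    is multiplication by the linear form with coefficients [a]. *)
Definition lin_mx_at (m : nat) (a : 'rV[K]_n) : 'M[K]_(h m, h m.+1) :=
  \sum_k a 0 k *: X m k.

Variable d : nat.
Hypothesis K0 : [pchar K] =i pred0.
Hypothesis XC : forall m k l, X m k *m X m.+1 l = X m l *m X m.+1 k.
Hypothesis socleX : forall m (v : 'rV[K]_(h m)),
  (m < d)%N -> v != 0 -> exists k, v *m X m k != 0.

Local Notation L := lin_mx_at.

Lemma lin_mx_comm m a b : L m a *m L m.+1 b = L m b *m L m.+1 a.
Proof.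
rewrite /L !mulmx_suml.
under eq_bigr do rewrite mulmx_sumr.
rewrite exchange_big /=; apply: eq_bigr => k _.
rewrite mulmx_sumr; apply: eq_bigr => l _.
by rewrite -!scalemxAl -!scalemxAr XC !scalerA mulrC.
Qed.

Lemma lin_mx_line m a b t : L m (a + t *: (b - a)) = L m a + t *: (L m b - L m a).
Proof.
rewrite /L -sumrB scaler_sumr -big_split; apply: eq_bigr => k _ /=.
by rewrite !mxE scalerDl -scalerA scalerBl.
Qed.

(* Here [F] is the dual of a quotient of the forms of degree [j], and its part
   killed by [a] is the dual of the restriction to the hyperplane [a = 0]. *)
Definition green j c s := forall m p (F : 'M[K]_(p, h m)),
  (m + j = d)%N -> (\rank F <= c)%N ->
  exists a, (\rank (F :&: kermx (L m a)) <= s)%N.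

Lemma green_mono j c c' s s' : (c' <= c)%N -> (s <= s')%N ->
  green j c s -> green j c' s'.
Proof.
move=> cc ss P m p F mj rF; have [a ha] := P m p F mj (leq_trans rF cc).
by exists a; apply: leq_trans ss.
Qed.

Lemma green00 : green 0 0 0.
Proof.
move=> m p F mj; rewrite leqn0 mxrank_eq0 => /eqP ->; exists 0.
by rewrite cap0mx mxrank0.
Qed.

Lemma greenS j c s : green j c s -> green j c.+1 s.+1.
Proof.
move=> P m p F mj; rewrite leq_eqVlt => /orP[/eqP rF|]; last first.
  by rewrite ltnS => rF; have [a ?] := P m p F mj rF; exists a; apply: leqW.
have [|G [GF rG]] := @submx_of_rank _ _ _ c F; first by rewrite rF.
have [a ha] := P m _ G mj (eq_leq rG).
by exists a; have := mxrank_cap_ker_le (L m a) GF; lia.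
Qed.

(** Below degree d there is no socle, so some variable does not kill a given nonzero vector. *)
Lemma green_line j : green j.+1 1 0.
Proof.
move=> m p F mj rF.
have [->|F0] := eqVneq F 0; first by exists 0; rewrite cap0mx mxrank0.
have [i vi] : exists i, row i F != 0.
  apply: NNPP => nex; case/eqP: F0; apply/row_matrixP => i.
  by rewrite row0; apply: NNPP => /eqP ne; apply: nex; exists i.
have [|k vk] := socleX _ vi; first by lia.
exists (delta_mx 0 k).
have -> : L m (delta_mx 0 k) = X m k.
  rewrite /L (bigD1 k) //= big1 ?addr0 ?mxE ?eqxx ?scale1r // => l lk.
  by rewrite mxE (negbTE lk) andbF scale0r.
have := mxrank_mul_ker F (X m k).
have : (0 < \rank (F *m X m k))%N.
  rewrite lt0n mxrank_eq0; apply/eqP => FX; case/eqP: vk.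
  by rewrite -row_mul FX row0.
lia.
Qed.

(** The minimizer plays the role of a generic linear form. *)
Lemma exists_min_cap_ker m p (F : 'M[K]_(p, h m)) :
  exists a, forall b, (\rank (F :&: kermx (L m a)) <= \rank (F :&: kermx (L m b)))%N.
Proof.
have [N] := ubnP (\rank (F :&: kermx (L m 0)))%N.
elim: N (0 : 'rV_n) => // N IH a aN.
case: (classic (exists b, \rank (F :&: kermx (L m b)) < \rank (F :&: kermx (L m a)))%N).
  by move=> [b ba]; apply: (IH b); lia.
by move=> nex; exists a => b; rewrite leqNgt; apply/negP => ba; apply: nex; exists b.
Qed.

(** Otherwise every form kills more than s dimensions of F. Let [a0] kill the fewest, and let [b]
    kill at most t1 of some s + 1 of these. A suitable [a] on a line through [a0] then kills at most
    t1 + t2 - (s + 1) dimensions more than [a0], hence fewer. *)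
Lemma green_rec j c c' s t1 t2 : green j.+1 s.+1 t1 -> green j c' t2 ->
  (c <= c' + s.+1)%N -> (t1 + t2 <= s)%N -> green j.+1 c s.
Proof.
move=> P1 P2 cc ts m p F mj rF; apply: NNPP => nex.
have big a : (s < \rank (F :&: kermx (L m a)))%N.
  by rewrite ltnNge; apply/negP => le; apply: nex; exists a.
have [a0 a0min] := exists_min_cap_ker F.
have [G [GF rG]] := submx_of_rank (big a0).
have [b Gb] := P1 m _ G mj (eq_leq rG).
(* Since [b] too kills at least s + 1 dimensions of F, the image of F under [b] has dimension at
   most c'. *)
have [||a1 FLa] := P2 m.+1 _ (F *m L m b); first by lia.
  by have := mxrank_mul_ker F (L m b); have := big b; lia.
pose Fb := (F :&: kermx (L m b))%MS.
pose r1 := \rank (Fb *m L m a0).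
pose r2 := \rank (F *m L m b *m L m.+1 a1).
(* A point [a] of the line through [a0] and [a1] that is generic for both. *)
have [t []] := @mxrank_line2 _ _ _ r1 _ _ r2 (Fb *m L m a0) (Fb *m L m a1)
  (F *m L m b *m L m.+1 a0) (F *m L m b *m L m.+1 a1) K0 (leqnn _) (leqnn _).
rewrite -!mulmxBr !scalemxAr -!mulmxDr -!lin_mx_line.
set a := a0 + _ => rk1 rk2.
pose Fa (x : 'rV[K]_n) := (F :&: kermx (L m x))%MS.
have FbE x : \rank (Fb :&: kermx (L m x)) = \rank (Fa x :&: kermx (L m b)).
  by rewrite /Fb /Fa -!capmxA (capmxC (kermx _)).
have Gcap := mxrank_cap_ker_le (L m b) GF.
have sub : (Fa a *m L m b <= (F *m L m b) :&: kermx (L m.+1 a))%MS.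
  rewrite sub_capmx submxMr ?capmxSl //=; apply/sub_kermxP.
  rewrite -mulmxA lin_mx_comm mulmxA.
  by have /sub_kermxP -> := capmxSr F (kermx (L m a)); rewrite mul0mx.
(* By [rk1], [a] kills no more of [Fb] than [a0] does; by [rk2], it kills no more of the image of F
   under [b] than [a1] does, so at most t2. *)
have := mxrankS sub.
have := mxrank_mul_ker (Fa a) (L m b).
have := mxrank_mul_ker Fb (L m a); have := mxrank_mul_ker Fb (L m a0).
have := mxrank_mul_ker (F *m L m b) (L m.+1 a).
have := mxrank_mul_ker (F *m L m b) (L m.+1 a1).
rewrite -/(Fa a0) in Gcap; rewrite /r1 /r2 in rk1 rk2.
have := FbE a; have := FbE a0; have := a0min a; rewrite -!/(Fa _); lia.
Qed.

(* For [s <= j] this is the sum of the binomials ['C(j + 1 - t, j - t)], [t < s],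
   plus [j - s]: the largest [c] whose Macaulay expansion in degree [j] drops to
   [s] under Green's restriction operation. *)
Definition green_num s j := (s.+1 * j - 'C(s, 2))%N.

Lemma bin2S k : 'C(k.+1, 2) = ('C(k, 2) + k)%N.
Proof. by rewrite binS bin1. Qed.

Lemma bin2_le k : ('C(k, 2) <= k * k)%N.
Proof. by elim: k => // k; rewrite bin2S; nia. Qed.

(** In this range the subtraction in [green_num] does not truncate. *)
Lemma green_numE s j : (s <= j)%N -> (green_num s j + 'C(s, 2) = s.+1 * j)%N.
Proof. by move=> sj; rewrite /green_num subnK //; have := bin2_le s; nia. Qed.

(** For fixed s, raising j by one adds s + 1 to [green_num s j], which is what [green_rec] allows
    with t1 = 0. *)
Lemma green_num_ok s j : (s <= j)%N -> green j (green_num s j) s.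
Proof.
elim: j s => [|j IH] s sj.
  by apply: green_mono green00; rewrite /green_num ?muln0.
have IH0 : green j.+1 j.+1 0.
  apply: green_rec (@green_line j) (IH 0%N _) _ _ => //.
  by rewrite /green_num bin0n; lia.
have [sj'|js] := leqP s j.
  apply: green_rec (green_mono _ (leqnn 0) IH0) (IH s _) _ _ => //.
  by have := green_numE sj; have := green_numE sj'; nia.
(* Now s + 1 = j + 2 is one more than [IH0] covers, so t1 = 1, and the induction hypothesis is used
   at s - 1. *)
have -> : s = j.+1 by lia.
apply: green_rec (greenS IH0) (IH j (leqnn j)) _ _; last by lia.
by have := green_numE (leqnn j); have := green_numE (leqnn j.+1); have := bin2S j; nia.
Qed.

(** In the Macaulay expansion in degree j, the leading binom(j+2,j) is sent by Green's operation to
    binom(j+1,j) = j + 1, and the remainder, in degree j - 1, to s. *)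
Lemma green_full j s : (s < j)%N ->
  green j ('C(j.+2, 2) + green_num s j.-1) (j.+1 + s).
Proof.
elim: j s => // j IH s; rewrite ltnS /= => sj.
have B2 := bin2S j.+2.
have [sj'|js] := ltnP s j.
  case: j => // j in IH sj sj' B2 *.
  have F1 : green j.+2 (j.+3 + s).+1 1.
    apply: green_mono (@green_num_ok 1 j.+2 _) => //.
    by rewrite /green_num bin_small //; lia.
  apply: green_rec F1 (IH s sj') _ _.
  - by have := green_numE sj; have := @green_numE s j sj'; rewrite /=; nia.
  - by lia.
(* The induction hypothesis does not reach s = j; it is used at s - 1, which leaves room for t1 =
   2. *)
have {sj js} -> : s = j by lia.
case: j => [|j] in IH B2 *.
  apply: green_mono (greenS (greenS (@green_line 0))) => //.
have F1 : green j.+2 (j.+3 + j.+1).+1 2.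
  apply: green_mono (@green_num_ok 2 j.+2 _) => //.
  by rewrite /green_num /= binn; lia.
apply: green_rec F1 (IH j _) _ _ => //.
- have := green_numE (leqnn j); have := green_numE (leqnn j.+1); have := bin2S j; rewrite /=; nia.
- by lia.
Qed.

(* [kermx (L m a)] is dual to the part of degree [d - m] of the quotient by the
   linear form [a], so the next three lemmas are growth bounds of Macaulay. *)
Lemma rank_ker_green m j c s a : (m + j.+1 = d)%N -> green j.+1 c s ->
  (\rank (kermx (L m.+1 a)) + s < c)%N -> (\rank (kermx (L m a)) < c)%N.
Proof.
move=> mj P ks; rewrite ltnNge; apply/negP => /submx_of_rank[G [GF rG]].
have [b Gb] := P m _ G mj (eq_leq rG).
(* Multiplication by [b] commutes with [a], so it carries G into the kernel one degree up and loses
   at most s dimensions. *)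
have sub : (G *m L m b <= kermx (L m.+1 a))%MS.
  apply/sub_kermxP; rewrite -mulmxA lin_mx_comm mulmxA.
  by move/sub_kermxP: GF => ->; rewrite mul0mx.
by have := mxrankS sub; have := mxrank_mul_ker G (L m b); lia.
Qed.

Lemma rank_ker_nonincr m j l a : (m + j = d)%N -> (l <= m)%N ->
  (\rank (kermx (L m a)) <= j)%N ->
  (\rank (kermx (L (m - l) a)) <= \rank (kermx (L m a)))%N.
Proof.
move=> mj; elim: l => [|l IH] lm kj; first by rewrite subn0.
have [p pE] : {p | m - l = p.+1}%N by exists (m - l).-1; lia.
have -> : (m - l.+1 = p)%N by lia.
have {IH} := IH (ltnW lm) kj; rewrite pE => IH.
have pj : (p + (d - p).-1.+1 = d)%N by lia.
(* Here c is the claimed bound plus 1, and c <= j + 1 <= d - p, the value of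
   [green_num 0 (d - p)]. *)
rewrite -ltnS; apply: (rank_ker_green pj (s := 0)); last by lia.
by apply: green_mono (@green_num_ok 0 _ _); rewrite /green_num ?bin0n; lia.
Qed.

Lemma rank_ker_growth m j l a : (m + j = d)%N -> (l <= m)%N ->
  (\rank (kermx (L m a)) <= j.*2)%N ->
  (\rank (kermx (L (m - l) a)) <= \rank (kermx (L m a)) + l)%N.
Proof.
move=> mj; elim: l => [|l IH] lm kj; first by rewrite subn0 addn0.
have [p pE] : {p | m - l = p.+1}%N by exists (m - l).-1; lia.
have -> : (m - l.+1 = p)%N by lia.
have {IH} := IH (ltnW lm) kj; rewrite pE => IH.
have pj : (p + (d - p).-1.+1 = d)%N by lia.
(* Here c <= 2j + l + 2 <= 2(d - p), the value of [green_num 1 (d - p)]. *)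
rewrite -ltnS; apply: (rank_ker_green pj (s := 1)); last by lia.
by apply: green_mono (@green_num_ok 1 _ _); rewrite /green_num ?bin_small; lia.
Qed.

(** * Lower bound for symmetric Hilbert functions *)

Hypothesis hsym : forall m m', (m + m' = d)%N -> h m = h m'.
Hypothesis rank_sym : forall m m' a, (m + m'.+1 = d)%N ->
  \rank (L m a) = \rank (L m' a).

Lemma hilbert_lower_bound :
  h 1 = (3 + 'C(d.+1, 2))%N ->
  (forall i, (0 < i < d)%N -> (h i <= 'C(i.+2, 2) + 'C((d - i).+2, 2))%N) ->
  forall i, (0 < i < d)%N -> ('C(i.+2, 2) + 'C((d - i).+2, 2) <= h i)%N.
Proof.
move=> h1 hle.
have half i : (0 < i)%N -> (i.*2 <= d)%N ->
    ('C(i.+2, 2) + 'C((d - i).+2, 2) <= h i)%N.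
  elim: i => // i IH _ id.
  case: i => [|i] in IH id *.
    by rewrite h1; have -> : ((d - 1).+2 = d.+1)%N by lia.
  have hi : h i.+1 = ('C(i.+3, 2) + 'C((d - i.+1).+2, 2))%N.
    by apply/eqP; rewrite eqn_leq hle ?IH //; lia.
  (* The degree called i in the overview is i + 2 here. *)
  set j := (d - i.+1)%N in hi.
  have ij : (i.+1 + j = d)%N by lia.
  have [a ka] : exists a, (\rank (kermx (L i.+1 a)) <= j.+1 + i.+2)%N.
    (* It suffices that binom(i+3,2) <= [green_num i.+2 j.-1], that is (i+2)^2 <= (i+3)(j-1), which
       holds as j >= i + 3. *)
    have P : green j (h i.+1) (j.+1 + i.+2).
      have ij2 : (i.+2 < j)%N by lia.
      apply: green_mono (green_full ij2) => //.
      have ij3 : (i.+2 <= j.-1)%N by lia.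
      have := mul_bin_diag i.+2 1; rewrite bin1 /= => twice.
      have := leq_mul (leqnn i.+3) ij3; have := green_numE ij3.
      by rewrite hi (bin2S i.+2); nia.
    have [|a] := P _ _ 1%:M ij; first exact: rank_leq_row.
    by rewrite cap1mx; exists a.
  have iq : (d - i.+2 + i.+2 = d)%N by lia.
  have e1 := mxrank_ker (L i.+1 a).
  have e2 := mxrank_ker (L (d - i.+2) a).
  have hd : h (d - i.+2) = h i.+2 by apply: hsym.
  have rk : \rank (L i.+1 a) = \rank (L (d - i.+2) a) by apply: rank_sym; lia.
  have r1 := rank_leq_row (L i.+1 a); have r2 := rank_leq_row (L (d - i.+2) a).
  (* The growth bounds go down from degree d - (i+2) to degree i + 1, which is j - (i+2) steps. *)
  have lE : (d - i.+2 - (d - i.+2 - i.+1) = i.+1)%N by lia.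
  have ker_le := rank_ker_nonincr (a := a) iq (leq_subr _ _ : (d - i.+2 - i.+1 <= d - i.+2)%N).
  have ker_gr := rank_ker_growth (a := a) iq (leq_subr _ _ : (d - i.+2 - i.+1 <= d - i.+2)%N).
  rewrite !lE in ker_le ker_gr.
  have dE : (d - i.+1 = (d - i.+2).+1)%N by lia.
  rewrite /j !dE !bin2S in hi ka *.
  (* The Perazzo value changes by i + 2 - j, so the kernel in degree i + 1 may exceed the one in
     degree d - (i+2) by at most j - (i+2). In the last case this follows from [ka]. *)
  have [k1|k1] := leqP (\rank (kermx (L (d - i.+2) a))) i.+2.
    by have := ker_le k1; lia.
  have [k2|k2] := leqP (\rank (kermx (L (d - i.+2) a))) i.+2.*2.
    by have := ker_gr k2; lia.
  lia.
move=> i /andP[i0 id]; have [|di] := leqP i.*2 d; first exact: half.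
have := half (d - i)%N; rewrite (@hsym (d - i) i); last by lia.
have -> : (d - (d - i) = i)%N by lia.
by rewrite addnC; apply; lia.
Qed.

End Core.

(** * Families independent or spanning modulo a subspace *)

Section SpanMod.

Variables (K : fieldType) (V : lmodType K) (S : V -> Prop).
Hypothesis S0 : S 0.
Hypothesis SZD : forall a u v, S u -> S v -> S (a *: u + v).

(** [S] is any subspace, so that these notions serve both modulo an ideal and modulo 0. *)
Definition free_mod h (v : 'I_h -> V) :=
  forall c : 'I_h -> K, S (\sum_j c j *: v j) -> forall j, c j = 0.

Definition in_span_mod h (v : 'I_h -> V) p :=
  exists c : 'I_h -> K, S (p - \sum_j c j *: v j).

Lemma sub_spaceZ a u : S u -> S (a *: u).
Proof. by move=> Su; rewrite -[_ *: _]addr0; apply: SZD. Qed.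

Lemma sub_spaceD u v : S u -> S v -> S (u + v).
Proof. by move=> Su Sv; rewrite -[u]scale1r; apply: SZD. Qed.

Lemma sub_space_sum (T : Type) (r : seq T) (P : pred T) (F : T -> V) :
  (forall i, P i -> S (F i)) -> S (\sum_(i <- r | P i) F i).
Proof. by move=> SF; apply: big_ind => //; apply: sub_spaceD. Qed.

Lemma in_span_modZD h (v : 'I_h -> V) a p q :
  in_span_mod v p -> in_span_mod v q -> in_span_mod v (a *: p + q).
Proof.
move=> [c cP] [c' c'P]; exists (fun j => a * c j + c' j).
have -> : a *: p + q - \sum_j (a * c j + c' j) *: v j =
    a *: (p - \sum_j c j *: v j) + (q - \sum_j c' j *: v j).
  rewrite scalerBr scaler_sumr addrACA -opprD -big_split /=; congr (_ - _).
  by apply: eq_bigr => j _; rewrite scalerDl scalerA.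
exact: SZD.
Qed.

Lemma in_span_mod0 h (v : 'I_h -> V) : in_span_mod v 0.
Proof. by exists (fun=> 0); rewrite big1 ?subr0 // => j _; rewrite scale0r. Qed.

Lemma in_span_mod_sum h (v : 'I_h -> V) (T : Type) (r : seq T) (P : pred T)
    (a : T -> K) (F : T -> V) :
  (forall i, P i -> in_span_mod v (F i)) ->
  in_span_mod v (\sum_(i <- r | P i) a i *: F i).
Proof.
move=> SF; elim/big_rec: _ => [|i p Pi Sp]; last exact: in_span_modZD (SF _ Pi) Sp.
exact: in_span_mod0.
Qed.

Lemma in_span_mod_self h (v : 'I_h -> V) j : in_span_mod v (v j).
Proof.
exists (fun k => (k == j)%:R); rewrite (bigD1 j) //= eqxx scale1r.
by rewrite big1 ?addr0 ?subrr // => k /negbTE ->; rewrite scale0r.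
Qed.

(** If h > N, the coefficient matrix has a nonzero left kernel, which gives a relation among the
    [v j] modulo S. *)
Lemma free_mod_le_span h N (v : 'I_h -> V) (w : 'I_N -> V) :
  free_mod v -> (forall j, in_span_mod w (v j)) -> (h <= N)%N.
Proof.
move=> fv sv; rewrite leqNgt; apply/negP => Nh.
have [C CP] := fin_all_exists sv.
pose A : 'M_(h, N) := \matrix_(j, k) C j k.
have : kermx A != 0.
  by rewrite kermx_eq0 /row_free; have := rank_leq_col A; lia.
case/eqP; apply/row_matrixP => i; apply/rowP => j; rewrite row0 [RHS]mxE.
apply: (fv (fun j => row i (kermx A) 0 j)).
have uA : row i (kermx A) *m A = 0 by rewrite -row_mul mulmx_ker row0.
have -> : \sum_j row i (kermx A) 0 j *: v j =
    \sum_j row i (kermx A) 0 j *: (v j - \sum_k C j k *: w k).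
  under [RHS]eq_bigr do rewrite scalerBr scaler_sumr.
  rewrite sumrB [X in _ - X]exchange_big /= [X in _ - X]big1 ?subr0 // => k _.
  transitivity ((row i (kermx A) *m A) 0 k *: w k); last by rewrite uA mxE scale0r.
  rewrite mxE scaler_suml; apply: eq_bigr => l _.
  by rewrite scalerA [A l k]mxE.
by apply: sub_space_sum => l _; apply: sub_spaceZ.
Qed.

Lemma exists_free_span (s : seq V) :
  exists (h : nat) (v : 'I_h -> V), [/\ forall j, v j \in s, free_mod v &
    forall p, p \in s -> in_span_mod v p].
Proof.
elim: s => [|p s [h [v [vs fv sv]]]].
  by exists 0%N, (fun=> 0); split=> [[]|c _ []|].
have [ps|nps] := classic (in_span_mod v p).
  exists h, v; split=> // [j|q]; first by rewrite inE vs orbT.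
  by rewrite inE => /orP[/eqP ->|/sv].
pose v' j := oapp v p (unlift ord0 j).
have sumE (c : 'I_h.+1 -> K) : \sum_j c j *: v' j =
    c ord0 *: p + \sum_j c (lift ord0 j) *: v j.
  rewrite big_ord_recl /v' unlift_none /=; congr (_ + _).
  by apply: eq_bigr => j _; rewrite liftK.
exists h.+1, v'; split.
- by move=> j; rewrite /v' inE; case: unliftP => [k|] _ /=; rewrite ?eqxx ?vs ?orbT.
- move=> c; rewrite sumE => Sc.
  have c0 : c ord0 = 0.
    apply: NNPP => /eqP c0; apply: nps.
    exists (fun j => - ((c ord0)^-1 * c (lift ord0 j))).
    have -> : p - \sum_j - ((c ord0)^-1 * c (lift ord0 j)) *: v j =
       (c ord0)^-1 *: (c ord0 *: p + \sum_j c (lift ord0 j) *: v j).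
      rewrite scalerDr scalerA mulVf // scale1r scaler_sumr -sumrN; congr (_ + _).
      by apply: eq_bigr => j _; rewrite scaleNr opprK scalerA.
    exact: sub_spaceZ.
  move: Sc; rewrite c0 scale0r add0r => /fv cl j.
  by case: (unliftP ord0 j) => [k|] ->.
- have old q : in_span_mod v q -> in_span_mod v' q.
    move=> [c cP]; exists (fun j => oapp c 0 (unlift ord0 j)).
    rewrite sumE unlift_none /= scale0r add0r.
    by under eq_bigr do rewrite liftK.
  move=> q; rewrite inE => /orP[/eqP ->|/sv/old //].
  exists (fun j => (j == ord0)%:R); rewrite sumE eqxx scale1r big1 ?addr0 ?subrr //.
  by move=> j _; rewrite eq_sym (negbTE (neq_lift _ _)) scale0r.
Qed.

End SpanMod.

(** * Hilbert functions of quotients by ideals *)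

Section Hilbert.

Variables (K : fieldType) (n : nat) (I : pred {mpoly K[n]}).
Hypothesis idI : is_ideal I.

Lemma ideal0 : 0 \in I. Proof. by case: idI. Qed.

Lemma idealMl q p : p \in I -> q * p \in I. Proof. by case: idI => _ _ IM Ip; apply: IM. Qed.

Lemma idealMr p q : p \in I -> p * q \in I.
Proof. by rewrite mulrC; apply: idealMl. Qed.

Lemma idealD p q : p \in I -> q \in I -> p + q \in I.
Proof. by case: idI => _ ID _ Ip Iq; apply: ID. Qed.

Lemma idealZ c p : p \in I -> c *: p \in I.
Proof. by rewrite -mul_mpolyC; apply: idealMl. Qed.

Lemma idealZD c p q : p \in I -> q \in I -> c *: p + q \in I.
Proof. by move=> Ip Iq; apply: idealD => //; apply: idealZ. Qed.

Lemma idealB p q : p \in I -> q \in I -> p - q \in I.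
Proof. by move=> Ip Iq; rewrite addrC -scaleN1r; apply: idealZD. Qed.

Lemma ideal_subr p q : p - q \in I -> (p \in I) = (q \in I).
Proof.
move=> Ipq; apply/idP/idP => [Ip|Iq]; last by rewrite -[p](subrK q) idealD.
by rewrite -[q](subKr p) idealB.
Qed.

Lemma ideal_eq_trans q p r : p - q \in I -> q - r \in I -> p - r \in I.
Proof. by move=> pq qr; rewrite -(subrK q p) -addrA idealD. Qed.

Lemma ideal_eq_sym p q : p - q \in I -> q - p \in I.
Proof. by move=> pq; rewrite -opprB -scaleN1r idealZ. Qed.

Lemma ideal_eqMr r p q : p - q \in I -> p * r - q * r \in I.
Proof. by rewrite -mulrBl; apply: idealMr. Qed.

Lemma ideal_eqMl r p q : p - q \in I -> r * p - r * q \in I.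
Proof. by rewrite -mulrBr; apply: idealMl. Qed.

Lemma ideal_eq_sum (T : Type) (r : seq T) (P : pred T) (F G : T -> {mpoly K[n]}) :
  (forall i, P i -> F i - G i \in I) ->
  \sum_(i <- r | P i) F i - \sum_(i <- r | P i) G i \in I.
Proof.
move=> FG; rewrite -sumrB; apply: (big_ind (fun p => p \in I)) => //.
  exact: ideal0.
exact: idealD.
Qed.

(** A basis modulo I is extracted from the monomials of degree i. With uniqueness, this makes the
    choice in [hilb] well defined. *)
Lemma HF_at_exists i : exists h, HF_at I i h.
Proof.
pose s := [seq 'X_[val m] : {mpoly K[n]} |
  m : 'X_{1..n < i.+1} <- enum {: 'X_{1..n < i.+1}} & mdeg (val m) == i].
have [h [v [vs fv sv]]] := exists_free_span ideal0 (@idealZD) s.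
exists h, v; split=> // [j|p hp].
  by have /mapP[m] := vs j; rewrite mem_filter => /andP[mi _] ->; rewrite dhomogX.
rewrite [p]mpolyE big_seq_cond.
apply: (in_span_mod_sum ideal0 (@idealZD)) => m; rewrite andbT => mp.
have mi : mdeg m = i by apply: dhomog_mf mp.
have mlt : (mdeg m < i.+1)%N by rewrite mi.
apply/sv/mapP; exists (BMultinom mlt) => //.
by rewrite mem_filter /= mi eqxx mem_enum.
Qed.

Lemma HF_at_uniq i h h' : HF_at I i h -> HF_at I i h' -> h = h'.
Proof.
move=> [v [vi fv sv]] [w [wi fw sw]]; apply/eqP; rewrite eqn_leq.
apply/andP; split.
  by apply: (free_mod_le_span ideal0 (@idealZD) fv (w := w)) => j; apply: sw.
by apply: (free_mod_le_span ideal0 (@idealZD) fw (w := v)) => j; apply: sv.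
Qed.

Lemma hilbP i : HF_at I i (hilb I i).
Proof. exact: epsilon_spec (HF_at_exists i). Qed.

Lemma hilbE i h : HF_at I i h -> hilb I i = h.
Proof. exact: HF_at_uniq (hilbP i). Qed.

End Hilbert.

(** * Self-duality of Gorenstein quotients *)

Section Duality.

Variables (K : fieldType) (n : nat) (J : pred {mpoly K[n]}) (d : nat).
Hypothesis K0 : [pchar K] =i pred0.
Hypothesis gorJ : SGAG J d.

Local Notation h := (hilb J).

Let idJ : is_ideal J. Proof. by case: gorJ => -[]. Qed.

Let bas m : 'I_(h m) -> {mpoly K[n]} :=
  sval (constructive_indefinite_description _ (hilbP idJ m)).

Arguments bas : clear implicits.

Let basP m : [/\ forall j, bas m j \is m.-homog, free_mod (fun p => p \in J) (bas m) &
  forall p, p \is m.-homog -> in_span_mod (fun p => p \in J) (bas m) p].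
Proof. exact: (svalP (constructive_indefinite_description _ (hilbP idJ m))). Qed.

(** Identifies row vectors with forms of degree m modulo J. *)
Let vec m (u : 'rV[K]_(h m)) : {mpoly K[n]} := \sum_j u 0 j *: bas m j.
Arguments vec : clear implicits.

Let vec_homog m u : vec m u \is m.-homog.
Proof.
by rewrite /vec; apply: rpred_sum => j _; apply: rpredZ; case: (basP m) => homb _ _; exact: homb.
Qed.

Let vec_inj m u : vec m u \in J -> u = 0.
Proof. by case: (basP m) => _ fb _ /fb u0; apply/rowP => j; rewrite u0 mxE. Qed.

Let vec_linear m a u v : vec m (a *: u + v) = a *: vec m u + vec m v.
Proof.
rewrite /vec scaler_sumr -big_split; apply: eq_bigr => j _ /=.
by rewrite !mxE scalerDl scalerA.
Qed.

Let vecB m u v : vec m (u - v) = vec m u - vec m v.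
Proof. by rewrite addrC -scaleN1r vec_linear scaleN1r addrC. Qed.

Let vec_eqJ m u v : vec m u - vec m v \in J -> u = v.
Proof. by rewrite -vecB => /vec_inj/eqP; rewrite subr_eq0 => /eqP. Qed.

Let crd m p : 'rV[K]_(h m) := epsilon (inhabits 0) (fun u => p - vec m u \in J).

Let crdP m p : p \is m.-homog -> p - vec m (crd m p) \in J.
Proof.
case: (basP m) => _ _ sb /sb [c cP]; apply: (@epsilon_spec _ _ (fun u => p - vec m u \in J)).
exists (\row_j c j); congr (_ \in J): cP; congr (_ - _).
by apply: eq_bigr => j _; rewrite mxE.
Qed.

Let X m k : 'M[K]_(h m, h m.+1) := \matrix_(i, j) crd m.+1 (bas m i * 'X_k) 0 j.

Lemma dhomog_var k : ('X_k : {mpoly K[n]}) \is 1.-homog.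
Proof. by rewrite dhomogX /= mdeg1. Qed.

Lemma dhomogMX m (p : {mpoly K[n]}) (k : 'I_n) : p \is m.-homog -> p * 'X_k \is m.+1.-homog.
Proof. by move=> hp; rewrite -addn1; apply: dhomogM hp (dhomog_var k). Qed.

Let vec_mul m p (u : 'rV_(h m)) (A : 'M_(h m, h p)) :
  vec p (u *m A) = \sum_i u 0 i *: vec p (row i A).
Proof.
rewrite /vec; under [RHS]eq_bigr do rewrite scaler_sumr.
rewrite exchange_big; apply: eq_bigr => j _ /=.
by rewrite mxE scaler_suml; apply: eq_bigr => i _; rewrite mxE scalerA.
Qed.

Let vecX m k u : vec m.+1 (u *m X m k) - vec m u * 'X_k \in J.
Proof.
rewrite vec_mul /vec mulr_suml; apply: ideal_eq_sum => // i _.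
rewrite -scalerAl -scalerBr; apply: idealZ => //; apply: ideal_eq_sym => //.
have -> : \sum_j row i (X m k) 0 j *: bas m.+1 j = vec m.+1 (crd m.+1 (bas m i * 'X_k)).
  by apply: eq_bigr => j _; rewrite !mxE.
by apply/crdP/dhomogMX; case: (basP m).
Qed.

Let XC m k l : X m k *m X m.+1 l = X m l *m X m.+1 k.
Proof.
have two u k' l' : vec m.+2 (u *m X m k' *m X m.+1 l') - vec m u * 'X_k' * 'X_l' \in J.
  exact: ideal_eq_trans (vecX _ _) (ideal_eqMr _ _ (vecX _ _)).
apply/row_matrixP => i; rewrite !rowE !mulmxA; apply: vec_eqJ.
apply: ideal_eq_trans (two _ _ _) _ => //.
by rewrite mulrAC; apply: ideal_eq_sym => //; apply: two.
Qed.

Local Notation L := (lin_mx_at X).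
Let lin (a : 'rV[K]_n) : {mpoly K[n]} := \sum_k a 0 k *: 'X_k.

Let vecL m a u : vec m.+1 (u *m L m a) - vec m u * lin a \in J.
Proof.
have -> : vec m.+1 (u *m L m a) = \sum_k a 0 k *: vec m.+1 (u *m X m k).
  rewrite /L mulmx_sumr /vec; under [RHS]eq_bigr do rewrite scaler_sumr.
  rewrite exchange_big; apply: eq_bigr => j _ /=.
  rewrite summxE scaler_suml; apply: eq_bigr => k _.
  by rewrite -scalemxAr mxE scalerA.
rewrite mulr_sumr; apply: ideal_eq_sum => // k _.
by rewrite -scalerAr -scalerBr; apply: idealZ => //; apply: vecX.
Qed.

(** A form of degree d outside J lies in the one-dimensional socle, so it can replace the given
    generator. *)
Let top_exists : exists t, [/\ t \is d.-homog, t \notin J &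
  forall p, in_socle J p -> exists c : K, p - c *: t \in J].
Proof.
case: gorJ => _ _ [s [sJ _ sP]] [[t [td tJ]] dP].
have tS : in_socle J t by move=> k; apply: dP (leqnn _) _; apply: dhomogMX.
exists t; split=> // p /sP [c cP]; have [b bP] := sP _ tS.
have b0 : b != 0.
  by apply: contraNneq tJ => b0; rewrite b0 scale0r subr0 in bP.
exists (c / b); apply: ideal_eq_trans cP _ => //.
have -> : c *: s - (c / b) *: t = - (c / b) *: (t - b *: s).
  by rewrite scaleNr scalerBr scalerA divfK // opprB.
exact: idealZ.
Qed.

Let top := sval (constructive_indefinite_description _ top_exists).

Let topP : [/\ top \is d.-homog, top \notin J &
  forall p, in_socle J p -> exists c : K, p - c *: top \in J].
Proof. exact: (svalP (constructive_indefinite_description _ top_exists)). Qed.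

Let top_inj c : c *: top \in J -> c = 0.
Proof.
case: topP => _ tJ _ cJ; apply/eqP; apply: contraNT tJ => c0.
by rewrite -[top]scale1r -(mulVf c0) -scalerA; apply: idealZ.
Qed.

(** Modulo J, [p] is a multiple of [top]; J is homogeneous, and the component of degree m of the
    difference is [p]. *)
Let socle_low m (p : {mpoly K[n]}) : p \is m.-homog -> (m < d)%N -> in_socle J p -> p \in J.
Proof.
case: topP => td _ tP pm md /tP [c cP].
case: gorJ => -[_ /(_ _ m cP)].
rewrite raddfB /= pihomog_dE // linearZ /= (pihomog_ne0 _ td) ?scaler0 ?subr0 //.
by rewrite gtn_eqF.
Qed.

Let nondeg m m' (p : {mpoly K[n]}) : (m + m' = d)%N -> p \is m.-homog ->
  (forall q, q \is m'.-homog -> p * q \in J) -> p \in J.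
Proof.
elim: m' m p => [|m' IH] m p mm pm pq.
  by rewrite -[p]mulr1; apply: pq; apply: dhomog1.
apply: (socle_low pm); first by lia.
move=> k; apply: IH (dhomogMX k pm) _; first by lia.
move=> q qm; rewrite -mulrA [_ * q]mulrC; apply: pq; exact: dhomogMX.
Qed.

Let phi p : K := epsilon (inhabits 0) (fun c => p - c *: top \in J).

Let phiP p : p \is d.-homog -> p - phi p *: top \in J.
Proof.
case: topP => _ _ tP pd; apply: (@epsilon_spec _ _ (fun c => p - c *: top \in J)).
apply: tP => k; case: gorJ => _ _ _ [_ dP].
by apply: dP (leqnn _) _; apply: dhomogMX.
Qed.

(** For m + m' = d, the Gram matrix of the multiplication pairing with values in A_d, identified
    with K through [top]. *)
Let B m m' : 'M[K]_(h m, h m') := \matrix_(i, j) phi (bas m i * bas m' j).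

Let vecB_top m m' u w : (m + m' = d)%N ->
  vec m u * vec m' w - (u *m B m m' *m w^T) 0 0 *: top \in J.
Proof.
move=> mm; have -> : (u *m B m m' *m w^T) 0 0 *: top =
    \sum_i \sum_j (u 0 i * w 0 j) *: (phi (bas m i * bas m' j) *: top).
  rewrite mxE exchange_big scaler_suml /=; apply: eq_bigr => j _.
  rewrite !mxE mulr_suml scaler_suml; apply: eq_bigr => i _.
  by rewrite !mxE scalerA mulrAC.
rewrite /vec mulr_suml; apply: ideal_eq_sum => // i _.
rewrite mulr_sumr; apply: ideal_eq_sum => // j _.
have -> : u 0 i *: bas m i * (w 0 j *: bas m' j) =
    (u 0 i * w 0 j) *: (bas m i * bas m' j).
  by rewrite -scalerAl -scalerAr scalerA.
rewrite -scalerBr; apply: idealZ => //.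
apply: phiP; rewrite -mm; apply: dhomogM.
  by case: (basP m).
by case: (basP m').
Qed.

Let B_free m m' : (m + m' = d)%N -> row_free (B m m').
Proof.
move=> mm; apply: inj_row_free => u uB; apply: vec_inj.
apply: (nondeg mm (vec_homog _)) => q qm.
rewrite (ideal_subr idJ (ideal_eqMl idJ _ (crdP qm))).
by rewrite (ideal_subr idJ (vecB_top _ _ mm)) uB mul0mx mxE scale0r ideal0.
Qed.

Let BT m m' : (B m m')^T = B m' m.
Proof. by apply/matrixP => i j; rewrite !mxE mulrC. Qed.

Lemma hilb_sym m m' : (m + m' = d)%N -> h m = h m'.
Proof.
move=> mm; have := B_free mm; rewrite -row_leq_rank => /leq_trans/(_ (rank_leq_col _)).
have mm' : (m' + m = d)%N by rewrite addnC.
have := B_free mm'; rewrite -row_leq_rank => /leq_trans/(_ (rank_leq_col _)).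
by move=> ? ?; apply/eqP; rewrite eqn_leq; apply/andP.
Qed.

(** Multiplication by a linear form is self-adjoint for the perfect pairing, so the two maps are
    transposes of each other up to factors that preserve the rank. *)
Let rank_sym m m' a : (m + m'.+1 = d)%N -> \rank (L m a) = \rank (L m' a).
Proof.
move=> mm; have mm1 : (m.+1 + m' = d)%N by lia.
have E : L m a *m B m.+1 m' = B m m'.+1 *m (L m' a)^T.
  have pair_eq (u : 'rV_(h m)) (w : 'rV_(h m')) : u *m (L m a *m B m.+1 m') *m w^T =
      u *m (B m m'.+1 *m (L m' a)^T) *m w^T.
    apply/rowP => i; rewrite ord1; apply/eqP; rewrite -subr_eq0.
    apply/eqP/top_inj; rewrite scalerBl mulmxA.
    have := vecB_top (u *m L m a) w mm1.
    have := vecB_top u (w *m L m' a) mm; rewrite trmx_mul !mulmxA => e1 e2.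
    apply: ideal_eq_trans (ideal_eq_sym idJ e2) _ => //.
    apply: ideal_eq_trans e1 => //.
    apply: ideal_eq_trans (ideal_eqMr idJ _ (vecL _ _)) _ => //.
    by rewrite -mulrA (mulrC (lin a)); apply: ideal_eq_sym => //; apply/ideal_eqMl/vecL.
  apply/row_matrixP => i; rewrite !rowE -[LHS]trmxK -[RHS]trmxK; congr trmx.
  apply/row_matrixP => j; rewrite !rowE; apply: trmx_inj.
  by rewrite !trmx_mul !trmxK pair_eq.
rewrite -(mxrankMfree (L m a) (B_free mm1)) E -mxrank_tr trmx_mul trmxK BT.
by rewrite mxrankMfree // B_free // addnC.
Qed.

Let socleX m (v : 'rV[K]_(h m)) : (m < d)%N -> v != 0 -> exists k, v *m X m k != 0.
Proof.
move=> md v0; apply: NNPP => nex; case/eqP: v0; apply/vec_inj/(socle_low (vec_homog _) md).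
move=> k; rewrite -(ideal_subr idJ (vecX _ _)).
have -> : v *m X m k = 0 by apply: NNPP => /eqP ?; apply: nex; exists k.
by rewrite /vec big1 ?ideal0 // => j _; rewrite mxE scale0r.
Qed.

Lemma hilb0 : h 0 = 1%N.
Proof.
apply: hilbE => //; exists (fun=> 1); split=> [_|c|p p0].
- exact: dhomog1.
- rewrite big_ord1 => cJ j; rewrite ord1; apply: NNPP => /eqP c0.
  case: topP => _ /negP tJ _; apply: tJ.
  have -> : top = (c ord0)^-1 *: top * (c ord0 *: 1).
    by rewrite -scalerAr mulr1 scalerA mulfV // scale1r.
  exact: idealMl.
- exists (fun=> p@_0%MM); rewrite big_ord1 alg_mpolyC.
  suff -> : p = (p@_0%MM)%:MP by rewrite mcoeffC eqxx mulr1 subrr ideal0.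
  apply/mpolyP => m; rewrite mcoeffC; have [->|m0] := eqVneq; first by rewrite mulr1.
  by rewrite mulr0 (dhomog_nemf_coeff p0) // mdeg_eq0.
Qed.

Lemma gorenstein_hilb_lower_bound : h 1 = (3 + 'C(d.+1, 2))%N ->
  (forall i, (0 < i < d)%N -> (h i <= 'C(i.+2, 2) + 'C((d - i).+2, 2))%N) ->
  forall i, (0 < i < d)%N -> ('C(i.+2, 2) + 'C((d - i).+2, 2) <= h i)%N.
Proof. exact: (hilbert_lower_bound K0 XC socleX hilb_sym rank_sym). Qed.

End Duality.

(** * Macaulay inverse systems *)

Section DiffAct.

Variables (K : fieldType) (n : nat).
Implicit Types p q f : {mpoly K[n]}.

(** An index set that does not depend on the support lets operators be added term by term. *)
Lemma diff_actwE k q p : (msize q <= k)%N ->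
  diff_act q p = \sum_(m : 'X_{1..n < k}) q@_m *: p^`M[m].
Proof.
move=> lt_qk; rewrite /diff_act.
pose P (m : 'X_{1..n < k}) := val m \in msupp q.
rewrite [RHS](bigID P) /P /= [X in _ + X]big1 ?addr0; last first.
  by move=> m /memN_msupp_eq0 ->; rewrite scale0r.
rewrite (big_mksub 'X_{1..n < k}) //=; first exact/msupp_uniq.
by move=> m /msize_mdeg_lt /leq_trans; apply.
Qed.

Lemma diff_actZD c q q' p :
  diff_act (c *: q + q') p = c *: diff_act q p + diff_act q' p.
Proof.
pose k := maxn (msize (c *: q + q')) (maxn (msize q) (msize q')).
rewrite !(@diff_actwE k) /k ?leq_max ?leqnn ?orbT //.
rewrite scaler_sumr -big_split; apply: eq_bigr => m _ /=.
by rewrite mcoeffD mcoeffZ scalerDl scalerA.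
Qed.

Lemma diff_act0 p : diff_act 0 p = 0.
Proof. by rewrite /diff_act msupp0 big_nil. Qed.

Lemma diff_actX m p : diff_act 'X_[m] p = p^`M[m].
Proof. by rewrite /diff_act msuppX big_seq1 mcoeffX eqxx scale1r. Qed.

Lemma diff_actZDr q c p p' : diff_act q (c *: p + p') = c *: diff_act q p + diff_act q p'.
Proof.
rewrite /diff_act scaler_sumr -big_split; apply: eq_bigr => m _ /=.
by rewrite mderivmD mderivmZ scalerDr !scalerA mulrC.
Qed.

Lemma diff_actr0 q : diff_act q 0 = 0.
Proof. by rewrite -[X in diff_act q X](subrr 0) -scaleN1r addrC diff_actZDr scaleN1r addNr. Qed.

Lemma diff_act_sum q (T : Type) (r : seq T) (a : T -> K) (F : T -> {mpoly K[n]}) :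
  diff_act (\sum_(i <- r) a i *: F i) q = \sum_(i <- r) a i *: diff_act (F i) q.
Proof.
elim: r => [|i r IH]; first by rewrite !big_nil diff_act0.
by rewrite !big_cons diff_actZD IH.
Qed.

Lemma diff_actM q q' p : diff_act (q * q') p = diff_act q (diff_act q' p).
Proof.
elim/mpolyind: q => [|c m q _ _ IH]; first by rewrite mul0r !diff_act0.
rewrite mulrDl -scalerAl !diff_actZD IH; congr (c *: _ + _) => {q IH}.
elim/mpolyind: q' => [|c' m' q _ _ IH].
  by rewrite mulr0 !diff_act0 diff_actr0.
rewrite mulrDr -scalerAr !diff_actZD diff_actZDr IH; congr (_ *: _ + _).
by rewrite -mpolyXD !diff_actX addmC mderivmDm.
Qed.

Lemma mderivm_homog f d m : f \is d.-homog -> (mdeg m <= d)%N ->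
  f^`M[m] \is (d - mdeg m).-homog.
Proof.
move=> fd md; apply/dhomogP => m'; rewrite mcoeff_msupp mcoeff_mderivm.
have [->|] := eqVneq (f@_(m + m')) 0; first by rewrite mul0rn eqxx.
rewrite -mcoeff_msupp => /(dhomog_mf fd) /= mm _; move: mm; rewrite mdegD; lia.
Qed.

Lemma mderivm_homog_eq0 f d m : f \is d.-homog -> (d < mdeg m)%N -> f^`M[m] = 0.
Proof.
move=> fd md; apply/mpolyP => m'; rewrite mcoeff_mderivm mcoeff0.
by rewrite (dhomog_nemf_coeff fd) ?mul0rn //= mdegD; lia.
Qed.

Lemma diff_act_homog_eq0 f d p i : f \is d.-homog -> p \is i.-homog ->
  (d < i)%N -> diff_act p f = 0.
Proof.
move=> fd pi di; rewrite /diff_act big_seq big1 // => m /(dhomog_mf pi) mi.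
by rewrite (mderivm_homog_eq0 fd) ?scaler0 // mi.
Qed.

(** The operators of degree j account for exactly the component of degree d - j of the result; hence
    [Ann f] is homogeneous. *)
Lemma diff_act_pihomog f d p j : f \is d.-homog -> (j <= d)%N ->
  diff_act (pihomog mdeg j p) f = pihomog mdeg (d - j) (diff_act p f).
Proof.
move=> fd jd; elim/mpolyind: p => [|c m p _ _ IH].
  by rewrite pihomog0 diff_act0 pihomog0.
rewrite linearP /= !diff_actZD IH linearP /=; congr (c *: _ + _).
rewrite pihomogX diff_actX; have [mj|mj] := eqVneq.
  by rewrite diff_actX pihomog_dE // -mj; apply: mderivm_homog; rewrite // mj.
rewrite diff_act0; have [md|md] := leqP (mdeg m) d.
  by rewrite (pihomog_ne0 _ (mderivm_homog fd md)) //; move: mj => /=; lia.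
by rewrite (mderivm_homog_eq0 fd md) pihomog0.
Qed.

Lemma in_Ann f p : (p \in Ann f) = (diff_act p f == 0).
Proof. by []. Qed.

Lemma Ann_ideal f : is_ideal (Ann f).
Proof.
split=> [|p q|p q]; rewrite !in_Ann ?diff_act0 //.
  by move=> /eqP p0 /eqP q0; rewrite -[p]scale1r diff_actZD p0 q0 scaler0 addr0.
by move=> /eqP p0; rewrite diff_actM p0 diff_actr0.
Qed.

Lemma Ann_homog f d : f \is d.-homog -> is_homog_ideal (Ann f).
Proof.
move=> fd; split=> [|p j]; first exact: Ann_ideal.
rewrite !in_Ann => /eqP pf; have [jd|dj] := leqP j d.
  by rewrite (diff_act_pihomog _ fd jd) pf pihomog0.
by rewrite (diff_act_homog_eq0 fd (pihomogP _ _ _) dj).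
Qed.

Lemma Ann_artinian f d : f \is d.-homog -> artinian (Ann f).
Proof.
move=> fd; have idI := Ann_ideal f.
pose v (j : 'I_#|{: 'X_{1..n < d.+1}}|) : {mpoly K[n]} := 'X_[val (enum_val j)].
exists #|{: 'X_{1..n < d.+1}}|, v => p.
change (in_span_mod (fun q => q \in Ann f) v p).
rewrite [p]mpolyE; apply: (in_span_mod_sum (ideal0 idI) (idealZD idI)) => m _.
have [md|dm] := ltnP (mdeg m) d.+1.
  have -> : 'X_[m] = v (enum_rank (BMultinom md)) by rewrite /v enum_rankK.
  exact: (@in_span_mod_self _ _ (fun q => q \in Ann f) (ideal0 idI)).
exists (fun=> 0); rewrite big1 => [|j _]; last by rewrite scale0r.
by rewrite subr0 in_Ann diff_actX (mderivm_homog_eq0 fd).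
Qed.

Hypothesis K0 : [pchar K] =i pred0.

Let natK_eq0 k : (k%:R == 0 :> K) = (k == 0)%N.
Proof. by have /pcharf0P -> := K0. Qed.

Lemma mderiv_eq0_const f : (forall i, f^`M(i) = 0) -> f = (f@_0%MM)%:MP.
Proof.
move=> f0; apply/mpolyP => m; rewrite mcoeffC; have [->|m0] := eqVneq; first by rewrite mulr1.
rewrite mulr0; have [i mi] : exists i, m i != 0%N.
  apply: NNPP => nex; case/eqP: m0; apply/mnmP => i; rewrite mnm0E.
  by apply: NNPP => /eqP ?; apply: nex; exists i.
have /mpolyP/(_ (m - U_(i))%MM) := f0 i.
rewrite mcoeff_mderiv mcoeff0 submK; last first.
  by apply/mnm_lepP => j; rewrite mnm1E; case: eqP => // <-; rewrite lt0n.
by move/eqP; rewrite -mulr_natr mulf_eq0 natK_eq0 orbF => /eqP.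
Qed.

(** The leading monomial of f, as an operator, sends f to a nonzero constant. A socle element sends
    f to a polynomial with zero partial derivatives, hence to a constant, and so is a multiple of
    this monomial modulo [Ann f]. *)
Lemma SGAG_Ann f d : f \is d.-homog -> f != 0 -> SGAG (Ann f) d.
Proof.
move=> fd f0; pose s : {mpoly K[n]} := 'X_[mlead f].
have md : mdeg (mlead f) = d by apply: dhomog_mf fd _ (mlead_supp f0).
pose c := mleadc f *+ \prod_(i < n) (mlead f i) ^_ (mlead f i).
have c0 : c != 0.
  rewrite /c -mulr_natr mulf_neq0 ?mleadc_eq0 // natK_eq0 -lt0n prodn_gt0 // => i.
  by rewrite ffactnn fact_gt0.
have sf : diff_act s f = c%:MP.
  rewrite diff_actX; apply/mpolyP => m; rewrite mcoeffC mcoeff_mderivm.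
  have [->|m0] := eqVneq; first by rewrite addm0 mulr1.
  rewrite (dhomog_nemf_coeff fd) ?mul0rn ?mulr0 //.
  by move: m0; rewrite /= mdegD md -mdeg_eq0; lia.
have sI : s \notin Ann f by rewrite in_Ann sf mpolyC_eq0.
have high j p : (d < j)%N -> p \is j.-homog -> p \in Ann f.
  by move=> dj pj; rewrite in_Ann (diff_act_homog_eq0 fd pj dj).
have sd : s \is d.-homog by rewrite dhomogX /= md.
split; [exact: Ann_homog fd|exact: Ann_artinian fd| |by split=> //; exists s].
exists s; split=> // [i|p pS]; first by apply: high (dhomogMX i sd).
have pf : diff_act p f = ((diff_act p f)@_0%MM)%:MP.
  apply: mderiv_eq0_const => i; rewrite -mderivmU1m -diff_actX -diff_actM mulrC.
  exact/eqP/pS.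
exists ((diff_act p f)@_0%MM / c).
rewrite in_Ann addrC -scaleNr diff_actZD sf {2}pf.
by rewrite scaleNr -mul_mpolyC -mpolyCM divfK // addNr.
Qed.

End DiffAct.

(** * The full Perazzo polynomial *)

(** Applying operators to f embeds the degree i part of the quotient into the span of the
    derivatives of f of order i. *)
Lemma hilb_Ann_le (K : fieldType) n (f : {mpoly K[n]}) i N (w : 'I_N -> {mpoly K[n]}) :
  (forall m, mdeg m = i -> in_span_mod (fun q => q = 0) w f^`M[m]) ->
  (hilb (Ann f) i <= N)%N.
Proof.
move=> sw; have ZD (a : K) (u v : {mpoly K[n]}) : u = 0 -> v = 0 -> a *: u + v = 0.
  by move=> -> ->; rewrite scaler0 addr0.
have [v [vi fv _]] := hilbP (Ann_ideal f) i.
apply: (@free_mod_le_span _ _ (fun q => q = 0) _ ZD _ _ (fun j => diff_act (v j) f) w) => //.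
  by move=> c /eqP; rewrite -diff_act_sum => /fv.
move=> j; rewrite /diff_act big_seq.
apply: in_span_mod_sum => // m mv; apply: sw.
exact: dhomog_mf (vi j) _ mv.
Qed.

Section Perazzo.

Variables (tau : nat).

Definition umon (a : 'X_{1..3}) : 'X_{1..tau + 3} :=
  [multinom if split i is inr k then a k else 0%N | i < tau + 3].

Lemma umon_l a j : umon a (lshift 3 j) = 0%N.
Proof. by rewrite mnmE -[lshift 3 j]/(unsplit (inl j)) unsplitK. Qed.

Lemma umon_r a k : umon a (rshift tau k) = a k.
Proof. by rewrite mnmE -[rshift tau k]/(unsplit (inr k)) unsplitK. Qed.

Lemma mnm_split_eq (m m' : 'X_{1..tau + 3}) :
  (forall j, m (lshift 3 j) = m' (lshift 3 j)) ->
  (forall k, m (rshift tau k) = m' (rshift tau k)) -> m = m'.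
Proof.
by move=> l r; apply/mnmP => i; case: (split_ordP i) => [j|k] ->.
Qed.

Lemma umon_inj : injective umon.
Proof. by move=> a b ab; apply/mnmP => k; rewrite -!umon_r ab. Qed.

Lemma mdeg_split (m : 'X_{1..tau + 3}) :
  mdeg m = (\sum_j m (lshift 3 j) + \sum_k m (rshift tau k))%N.
Proof. by rewrite mdegE big_split_ord. Qed.

Lemma mdeg_umon a : mdeg (umon a) = mdeg a.
Proof.
rewrite mdeg_split big1 => [|j _]; last exact: umon_l.
by rewrite mdegE; apply: eq_bigr => k _; rewrite umon_r.
Qed.

Lemma umonE (m : 'X_{1..tau + 3}) : (forall j, m (lshift 3 j) = 0%N) ->
  exists a, m = umon a.
Proof.
move=> m0; exists [multinom m (rshift tau k) | k < 3].
by apply: mnm_split_eq => [j|k]; rewrite ?umon_l ?umon_r ?mnmE.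
Qed.

Variables (K : fieldType) (d : nat) (e : 'I_tau -> 'X_{1..3}).
Hypothesis K0 : [pchar K] =i pred0.
Hypothesis d_ge4 : (4 <= d)%N.
Hypothesis e_inj : injective e.
Hypothesis e_deg : forall j, mdeg (e j) = d.-1.
Hypothesis e_onto : forall m : 'X_{1..3}, mdeg m = d.-1 -> exists j, e j = m.

Local Notation f := (perazzo K e).

Definition perazzo_mon j : 'X_{1..tau + 3} := (U_(lshift 3 j) + umon (e j))%MM.
Local Notation mu := perazzo_mon.

Lemma mu_l j j' : mu j (lshift 3 j') = (j == j').
Proof. by rewrite mnmDE umon_l addn0 mnm1E (inj_eq (@lshift_inj _ _)). Qed.

Lemma perazzoE : f = \sum_j 'X_[mu j].
Proof.
apply: eq_bigr => j _; rewrite mpolyXD; congr (_ * _).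
rewrite [RHS]mpolyXE_id [RHS]big_split_ord /= [X in _ = X * _]big1 ?mul1r => [|l _].
  by apply: eq_bigr => k _; rewrite umon_r.
by rewrite umon_l expr0.
Qed.

Lemma mdeg_mu j : mdeg (mu j) = d.
Proof. by rewrite mdegD mdeg1 mdeg_umon e_deg; lia. Qed.

Lemma perazzo_homog : f \is d.-homog.
Proof. by rewrite perazzoE; apply: rpred_sum => j _; rewrite dhomogX /= mdeg_mu. Qed.

Lemma mcoeff_perazzo_xu j a : f@_(U_(lshift 3 j) + umon a) = (e j == a)%:R.
Proof.
rewrite perazzoE raddf_sum /= (bigD1 j) //= big1 ?addr0 => [|l lj].
  by rewrite mcoeffX (inj_eq (@addmI _ _)) (inj_eq umon_inj).
rewrite mcoeffX; case: eqP => // /mnmP/(_ (lshift 3 j)).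
by rewrite mu_l mnmDE umon_l mnm1E eqxx (negbTE lj).
Qed.

Lemma mcoeff_perazzo_u a : f@_(umon a) = 0.
Proof.
rewrite perazzoE raddf_sum /= big1 // => l _; rewrite mcoeffX; case: eqP => //.
by move=> /mnmP/(_ (lshift 3 l)); rewrite mu_l eqxx umon_l.
Qed.

Let mdeg_Uk k b : mdeg (U_(k) *+ b : 'X_{1..3})%MM = b.
Proof. by rewrite mdegMn mdeg1 mul1n. Qed.

Lemma perazzo_neq0 : f != 0.
Proof.
have [j ej] := e_onto (mdeg_Uk ord0 d.-1).
apply/eqP => /mpolyP/(_ (mu j)).
by rewrite mcoeff_perazzo_xu eqxx mcoeff0 => /eqP; rewrite oner_eq0.
Qed.

Lemma hilb_perazzo1 : hilb (Ann f) 1 = (tau + 3)%N.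
Proof.
apply: hilbE; first exact: Ann_ideal.
exists (fun k => 'X_k); split=> [k|c|p p1]; first exact: dhomog_var.
  rewrite in_Ann diff_act_sum => /eqP/mpolyP c0.
  have coefE m : \sum_k c k * (f@_(m + U_(k)) *+ (m k).+1) = 0.
    rewrite -[RHS](mcoeff0 _ m) -c0 raddf_sum; apply: eq_bigr => k _ /=.
    by rewrite mcoeffZ diff_actX mderivmU1m mcoeff_mderiv.
  have cl j : c (lshift 3 j) = 0.
    (* Every monomial of f contains some x, so the coefficient at M_j sees only the derivative by
       x_j. *)
    have := coefE (umon (e j)); rewrite big_split_ord /= [X in _ + X]big1 => [|k _]; last first.
      have -> : (umon (e j) + U_(rshift tau k) = umon (e j + U_(k)))%MM.
        apply: mnm_split_eq => [l|l]; rewrite mnmDE ?umon_l ?umon_r mnm1E.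
          by rewrite eq_rlshift.
        by rewrite mnmDE mnm1E (inj_eq (@rshift_inj _ _)).
      by rewrite mcoeff_perazzo_u mul0rn mulr0.
    rewrite addr0 (bigD1 j) //= big1 ?addr0 => [|l lj].
      by rewrite addmC mcoeff_perazzo_xu eqxx umon_l mulr1.
    by rewrite addmC mcoeff_perazzo_xu (inj_eq e_inj) (negbTE lj) mul0rn mulr0.
  move=> i; case: (split_ordP i) => [j|k] -> //.
  have [j ej] := e_onto (mdeg_Uk k d.-1).
  (* With M_j = u_k^(d-1), the coefficient at x_j u_k^(d-2) is (d-1) c_k. *)
  pose a : 'X_{1..3} := (U_(k) *+ d.-2)%MM.
  have := coefE (U_(lshift 3 j) + umon a)%MM.
  rewrite big_split_ord /= big1 ?add0r => [|l _]; last by rewrite cl mul0r.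
  have fE l : f@_(U_(lshift 3 j) + umon a + U_(rshift tau l)) = (k == l)%:R.
    have -> : (U_(lshift 3 j) + umon a + U_(rshift tau l) =
               U_(lshift 3 j) + umon (a + U_(l)))%MM.
      rewrite -addmA; congr (_ + _)%MM.
      apply: mnm_split_eq => [o|o]; rewrite mnmDE ?umon_l ?umon_r mnm1E.
        by rewrite eq_rlshift.
      by rewrite mnmDE mnm1E (inj_eq (@rshift_inj _ _)).
    rewrite mcoeff_perazzo_xu ej; have [<-|kl] := eqVneq k l.
      have -> : (U_(k) *+ d.-1 = a + U_(k))%MM; last by rewrite eqxx.
      have -> : d.-1 = d.-2.+1 by lia.
      by rewrite mulmSr.
    case: eqP => // /mnmP/(_ l); rewrite mulmnE mnmDE mulmnE !mnm1E eqxx (negbTE kl).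
    by rewrite !mul0n.
  rewrite (bigD1 k) //= big1 ?addr0 => [|l lk]; last first.
    by rewrite fE eq_sym (negbTE lk) mul0rn mulr0.
  move/eqP; rewrite fE eqxx mulf_eq0 => /orP[/eqP //|].
  by move/pcharf0P: K0 => ->.
rewrite [p]mpolyE big_seq_cond.
apply: (in_span_mod_sum (ideal0 (Ann_ideal f)) (idealZD (Ann_ideal f))) => m.
rewrite andbT => /(dhomog_mf p1) /= /eqP; rewrite mdeg_eq1 => /existsP[k /eqP ->].
exact: (@in_span_mod_self _ _ (fun q => q \in Ann f) (ideal0 (Ann_ideal f)) _ (fun k => 'X_k) k).
Qed.

(** Each monomial of f is linear in the x, so one derivative by an x leaves a monomial in u alone or
    0. *)
Lemma mderivmX_mu_u (m : 'X_{1..tau + 3}) l j : m (lshift 3 l) != 0%N ->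
  (exists2 b, mdeg b = (d - mdeg m)%N &
     exists c : K, 'X_[mu j]^`M[m] = c *: 'X_[umon b]) \/
  'X_[mu j]^`M[m] = 0 :> {mpoly K[tau + 3]}.
Proof.
move=> ml; rewrite mderivmX.
have [mj|mj] := boolP (m <= mu j)%MM; last first.
  right; have [i] : exists i, (mu j i < m i)%N.
    apply: NNPP => nex; case/negP: mj; apply/mnm_lepP => i.
    by rewrite leqNgt; apply/negP => ij; apply: nex; exists i.
  by move=> ij; rewrite (bigD1 i) //= ffact_small // mul0n scale0r.
left; have [|b bE] := @umonE (mu j - m).
  move=> j'; rewrite mnmBE mu_l; have [<-{j'}|_] := eqVneq; last by rewrite sub0n.
  have /mnm_lepP/(_ (lshift 3 l)) := mj; rewrite mu_l.
  by move: ml; have [<-|_] := eqVneq j l; case: (m _) => [|[]].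
exists b; last by rewrite bE; eexists.
by rewrite -mdeg_umon -bE -(mdeg_mu j) -{2}(submK mj) mdegD addnK.
Qed.

(** The first binomial counts the derivatives of order i by the u alone; all others lie in the span
    of the u-monomials of degree d - i, which the second counts. *)
Lemma hilb_perazzo_le i : (i <= d)%N ->
  (hilb (Ann f) i <= 'C(i.+2, 2) + 'C((d - i).+2, 2))%N.
Proof.
move=> id; pose sb k := [seq s2m t | t : k.-tuple 'I_3 <- enum (basis 3 k)].
have sz k : size (sb k) = 'C(k.+2, 2).
  by rewrite size_basis addn2 -[RHS]bin_sub // !subSS subn0.
rewrite -!sz.
pose w (j : 'I_(size (sb i) + size (sb (d - i)%N))) : {mpoly K[tau + 3]} :=
  match split j with
  | inl k => f^`M[umon (nth 0%MM (sb i) k)]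
  | inr k => 'X_[umon (nth 0%MM (sb (d - i)%N) k)]
  end.
have w_u a : mdeg a = i -> exists j, w j = f^`M[umon a].
  move=> /eqP; rewrite basis_cover => ai.
  have lt := ai; rewrite -index_mem in lt.
  exists (unsplit (inl (Ordinal lt))).
  by rewrite /w unsplitK /= nth_index.
have w_x b : mdeg b = (d - i)%N -> exists j, w j = 'X_[umon b].
  move=> /eqP; rewrite basis_cover => bi.
  have lt := bi; rewrite -index_mem in lt.
  exists (unsplit (inr (Ordinal lt))).
  by rewrite /w unsplitK /= nth_index.
have ZD (a : K) (u v : {mpoly K[tau + 3]}) : u = 0 -> v = 0 -> a *: u + v = 0.
  by move=> -> ->; rewrite scaler0 addr0.
apply: (hilb_Ann_le (w := w)) => m mi.
have [|/not_all_ex_not[l /eqP ml]] := classic (forall j, m (lshift 3 j) = 0%N).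
  move=> /umonE[a aE]; rewrite aE mdeg_umon in mi *.
  have [j <-] := w_u a mi; exact: in_span_mod_self.
rewrite perazzoE raddf_sum /=.
under eq_bigr do rewrite -[_^`M[m]]scale1r.
apply: in_span_mod_sum => // j _.
have [[b bd [c ->]]|->] := mderivmX_mu_u j ml.
  rewrite mi in bd; have [o <-] := w_x b bd.
  rewrite -[_ *: _]addr0; apply: in_span_modZD => //; first exact: in_span_mod_self.
  exact: in_span_mod0.
exact: in_span_mod0.
Qed.

End Perazzo.

(** * Minimality of the Perazzo Hilbert function *)

Theorem theorem4p2 (K : fieldType) (K_char0 : [pchar K] =i pred0)
  (d : nat) (d_ge4 : (4 <= d)%N)
  (e : 'I_('C(d.+1, 2)) -> 'X_{1..3})
  (e_inj : injective e)
  (e_deg : forall j, mdeg (e j) = d.-1)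
  (e_onto : forall m : 'X_{1..3}, mdeg m = d.-1 -> exists j, e j = m) :
  let tau := 'C(d.+1, 2) in
  let r := (3 + tau)%N in
  let I := Ann (perazzo K e) in
  SGAG I d /\ hilb I 1 = r /\
  forall (n : nat) (J : pred {mpoly K[n]}),
    SGAG J d -> hilb J 1 = r ->
    (forall i, (i <= d)%N -> (hilb J i <= hilb I i)%N) ->
    forall i, (i <= d)%N -> hilb J i = hilb I i.
Proof.
move=> tau r I.
have gorI : SGAG I d.
  by apply: SGAG_Ann (perazzo_homog K d_ge4 e_deg) (perazzo_neq0 K e_onto).
have I1 : hilb I 1 = r by rewrite /r [RHS]addnC; apply: (hilb_perazzo1 K_char0 d_ge4 e_inj e_onto).
have Ile i : (i <= d)%N -> (hilb I i <= 'C(i.+2, 2) + 'C((d - i).+2, 2))%N.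
  exact: hilb_perazzo_le.
split=> //; split=> // n J gorJ J1 JI i id; apply/eqP; rewrite eqn_leq JI //=.
(* In degrees 0 and d both Hilbert functions equal 1; in between, the Perazzo value lies between
   [hilb I i] and [hilb J i]. *)
have [->|i0] := eqVneq i 0%N; first by rewrite (hilb0 gorI) (hilb0 gorJ).
have [->|id'] := eqVneq i d.
  by rewrite (hilb_sym gorI (addn0 d)) (hilb_sym gorJ (addn0 d)) (hilb0 gorI) (hilb0 gorJ).
apply: leq_trans (Ile i id) _.
apply: (gorenstein_hilb_lower_bound K_char0 gorJ J1); last by lia.
by move=> k kd; apply: leq_trans (JI k _) (Ile k _); lia.
Qed.
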